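(* Let $q$ be a prime power and let $\mathcal{C}$ be an $[n,k]_q$ code. If $k/n\leq 3/5$, then for every integer $t$ with $1\leq t\leq\min\{k,n-k\}$, \[ \delta_t(\mathcal{C})\leq R_t(\mathcal{C}).\]
   Context: An $[n,k]_q$ code $\mathcal{C}$ is a $k$-dimensional $\mathbb{F}_q$-linear subspace of $\mathbb{F}_q^n$. For a matrix $V\in\mathbb{F}_q^{t\times n}$, $\operatorname{wt}(V)$ is the number of non-zero columns of $V$, and $d(V,V')=\operatorname{wt}(V-V')$. For an integer $t\geq 1$, $\mathcal{C}^t$ is the set of matrices in $\mathbb{F}_q^{t\times n}$ all of whose rows are in $\mathcal{C}$. For $1\leq t\leq k$, the $t$-th generalized Hamming weight is $d_t(\mathcal{C})=\min\{\operatorname{wt}(C): C\in\mathcal{C}^t,\ \operatorname{rank} C=t\}$, and $\delta_t(\mathcal{C})=\lfloor (d_t(\mathcal{C})-1)/2\rfloor$. The $t$-th generalized covering radius is $R_t(\mathcal{C})=\max_{V\in\mathbb{F}_q^{t\times n}}\min_{C\in\mathcal{C}^t} d(V,C)$. *)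

(* Defs.v *)
From mathcomp Require Import all_boot all_order all_algebra.

Set Implicit Arguments.
Unset Strict Implicit.
Unset Printing Implicit Defensive.

Import Order.TTheory GRing.Theory Num.Theory.

Local Open Scope ring_scope.

Definition mxwt (F : finFieldType) (t n : nat) (V : 'M[F]_(t, n)) : nat :=
  #|[set j : 'I_n | col j V != 0]|.

Definition mxdist (F : finFieldType) (t n : nat) (V V' : 'M[F]_(t, n)) : nat :=
  mxwt (V - V').

Definition code_pow (F : finFieldType) (n : nat) (C : {vspace 'rV[F]_n})
    (t : nat) : {set 'M[F]_(t, n)} :=
  [set M | [forall i, row i M \in C]].

(* Since mxwt <= n always, the default value n in the iterated minima below
   does not change the minimum over a nonempty range.  The range in ghw is
   nonempty exactly when t <= \dim C; the one in gcovrad contains 0. *)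
Definition ghw (F : finFieldType) (n : nat) (C : {vspace 'rV[F]_n})
    (t : nat) : nat :=
  \big[minn/n]_(M in code_pow C t | \rank M == t) mxwt M.

Definition packrad (F : finFieldType) (n : nat) (C : {vspace 'rV[F]_n})
    (t : nat) : nat :=
  ((ghw C t - 1) %/ 2)%N.

Definition gcovrad (F : finFieldType) (n : nat) (C : {vspace 'rV[F]_n})
    (t : nat) : nat :=
  \max_(V : 'M[F]_(t, n)) \big[minn/n]_(M in code_pow C t) mxdist V M.

(* Main.v *)
(* Let r = n - k and let d = delta_t(C); one always has t <= R_t(C).

   If t >= 4 and R_t(C) <= s = d - 1, then covering all t x n matrices by balls
   of radius s gives q^(t(r - s)) <= 'C(n, s), while the Singleton bound for
   generalized weights gives 2s + 3 <= r + t.  Together with t <= s and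
   2n <= 5r (the rate hypothesis) this is impossible already for q = 2.

   If t <= 3 the rate plays no role.  Choose nonzero vectors v_0, ..., v_(d-1)
   of F^t such that every j-dimensional subspace with 0 < j < t contains at
   most (d + 1) / (t - j + 1) of them, and place them one at a time as the
   columns of a matrix V, keeping 0 a nearest element of C^t to V.  If v_m has
   no admissible position, then each position i outside T = supp V is in the
   support of some M_i in C^t of rank < t whose support leaves T in at most as
   many places as there are v_a in the column space of M_i.  Starting from an
   M_i of maximal rank and adding M_i's at uncovered positions produces a
   subcode of dimension at least t with support of size at most 2d < d_t(C). *)

Require Import Defs.
From mathcomp Require Import all_boot all_order all_algebra.
From mathcomp Require Import zify.

Set Implicit Arguments.
Unset Strict Implicit.
Unset Printing Implicit Defensive.

Import Order.TTheory GRing.Theory Num.Theory.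

(** * Binomial estimates *)

(** The quotient of ['C(n+1, s)] by ['C(n, s)] is [(n+1) / (n+1-s)], which the hypothesis bounds by
    [a / b]. *)
Lemma bin_upper_succ (a b n s : nat) :
  (b * n.+1 <= a * (n.+1 - s) -> b * 'C(n.+1, s) <= a * 'C(n, s))%N.
Proof.
have [sn|ns] := leqP s n => h; last first.
  have e : (n.+1 - s = 0)%N by lia.
  by move: h; rewrite e; case: b => // b; rewrite muln0 leqn0.
have e := mul_bin_down n.+1 s; rewrite /= in e.
rewrite -(@leq_pmul2l (n.+1 - s)) ?subn_gt0 // mulnCA -e mulnA.
by rewrite [leqRHS]mulnCA [leqRHS]mulnA leq_mul2r h orbT.
Qed.

(** The quotient [(n+1) / (n+1-s)] decreases as [n] grows, so its bound at the first of the [m]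
    steps serves for all of them. *)
Lemma bin_upper_add (a b n s m : nat) :
  (b <= a -> b * n.+1 <= a * (n.+1 - s) ->
   b ^ m * 'C(n + m, s) <= a ^ m * 'C(n, s))%N.
Proof.
move=> ba h; elim: m => [|m IHm]; first by rewrite addn0.
have step : (b * 'C((n + m).+1, s) <= a * 'C(n + m, s))%N.
  apply: bin_upper_succ; have [sn|ns] := leqP s n.+1; last first.
    have e : (n.+1 - s = 0)%N by lia.
    move: h; rewrite e muln0 leqn0 muln_eq0 orbF => /eqP->.
    by rewrite mul0n.
  have -> : ((n + m).+1 - s = n.+1 - s + m)%N by lia.
  have -> : ((n + m).+1 = n.+1 + m)%N by lia.
  by rewrite !mulnDr leq_add // leq_mul2r ba orbT.
rewrite addnS !expnSr -mulnA; apply: (@leq_trans (b ^ m * (a * 'C(n + m, s)))).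
  by rewrite leq_mul2l step orbT.
by rewrite mulnCA [leqRHS]mulnAC [leqRHS]mulnC leq_mul2l IHm orbT.
Qed.

(** One diagonal step to ['C(n+1, s+1)], then four upward steps: the effect on
    [n = (5 * (s + u))./2] of raising both [s] and [u] by 1. *)
Lemma bin_diag_add4 (a b n s : nat) :
  (b <= a -> b * n.+2 <= a * (n.+2 - s.+1) ->
   b ^ 4 * s.+1 * 'C(n + 5, s.+1) <= a ^ 4 * n.+1 * 'C(n, s))%N.
Proof.
move=> ba h; have := bin_upper_add 4 ba h.
have -> : (n.+1 + 4 = n + 5)%N by lia.
have := mul_bin_diag n.+1 s; rewrite /= => e h4.
by rewrite -(mulnA (a ^ 4)) e -(mulnA (b ^ 4)) !(mulnCA _ s.+1) leq_mul2l h4 orbT.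
Qed.

(** The upper argument grows by at most 3, each unit costs a factor at most 5/3, and (5/3)^3 =
    125/27 < 5. *)
Lemma bin_half5_succr (s u : nat) :
  ('C((5 * (s + u.+1))./2, s) <= 5 * 'C((5 * (s + u))./2, s))%N.
Proof.
set n := (5 * (s + u))./2.
have h : (3 * n.+1 <= 5 * (n.+1 - s))%N by rewrite /n; lia.
have := bin_upper_add 3 (isT : 3 <= 5) h.
have : ('C((5 * (s + u.+1))./2, s) <= 'C(n + 3, s))%N.
  by apply: leq_bin2l; rewrite /n; lia.
rewrite -[3 ^ 3]/27 -[5 ^ 3]/125; lia.
Qed.

(* Induction by steps of 2, over which (5 * (t + 3))./2 grows by exactly 5. *)
Lemma bin_half5_diag (t : nat) :
  (4 <= t -> 'C((5 * (t + 3))./2, t) < 8 ^ t)%N.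
Proof.
suff H m : ('C((5 * (m + 4 + 3))./2, m + 4) < 8 ^ (m + 4))%N /\
           ('C((5 * (m + 5 + 3))./2, m + 5) < 8 ^ (m + 5))%N.
  by move=> t4; have [] := H (t - 4)%N; rewrite subnK.
clear t; elim: m => [|m [IH IH']].
  by split; vm_compute.
split.
  by rewrite addSnnS.
move: IH {IH'}; set t := (m + 4)%N; set n := (5 * (t + 3))./2 => IH.
have t4 : (4 <= t)%N by rewrite /t; lia.
have -> : (m.+1 + 5 = t.+2)%N by rewrite /t; lia.
have -> : ((5 * (t.+2 + 3))./2 = n.+2 + 3)%N by rewrite /n; lia.
have h : (3 * n.+3 <= 5 * (n.+3 - t.+2))%N by rewrite /n; lia.
have := bin_upper_add 3 (isT : 3 <= 5) h.
have := mul_bin_diag n.+1 t; have := mul_bin_diag n.+2 t.+1.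
rewrite /= -[3 ^ 3]/27 -[5 ^ 3]/125 !expnS.
(* The two diagonal steps cost a factor at most 13 and the three upward ones at most 125/27; their
   product 1625/27 is below 64 = 8^2. *)
have nt : (n.+1 * n.+2 <= 13 * (t.+1 * t.+2))%N.
  have : (2 * n <= 5 * (t + 3))%N by rewrite /n; lia.
  nia.
move: IH; set c0 := 'C(n, t); set c1 := 'C(_, t.+1); set c2 := 'C(_, t.+2).
set c3 := 'C(_, t.+2); move: (8 ^ t)%N => E cE e2 e1 h3.
have e3 : (t.+1 * t.+2 * c2 = n.+1 * n.+2 * c0)%N by nia.
have : (t.+1 * t.+2 * (27 * c3) <= t.+1 * t.+2 * (1625 * c0))%N.
  apply: (@leq_trans (t.+1 * t.+2 * (125 * c2))); first by rewrite leq_mul2l h3 orbT.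
  by rewrite mulnCA e3; nia.
by rewrite leq_pmul2l ?muln_gt0 //; lia.
Qed.

(** Induction on [s] from [s = t]. A step raises the upper argument [n] by 5 and may cost a factor
    at most [2 ^ t]. Since [n + 1 <= 5 * (s + 1)], its diagonal part costs at most 5, and the four
    upward steps must fit in the rest. *)
Lemma bin_half5_min (t s : nat) :
  (4 <= t <= s -> 'C((5 * (s + (s + 3 - t)))./2, s) < 2 ^ (t * (s + 3 - t)))%N.
Proof.
case/andP=> t4; elim: s => [|s IHs]; first by lia.
rewrite leq_eqVlt => /orP[/eqP<-|ts].
  have -> : (t + 3 - t = 3)%N by lia.
  by rewrite (mulnC t) expnM; apply: bin_half5_diag.
have {IHs} := IHs ts.
have -> : (s.+1 + 3 - t = (s + 3 - t).+1)%N by lia.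
rewrite mulnS expnD.
have -> : ((5 * (s.+1 + (s + 3 - t).+1))./2 = (5 * (s + (s + 3 - t)))./2 + 5)%N.
  by lia.
(* In this case [n = 17], and the first upward quotient 19/14 just exceeds the 4/3 used below for
   [t = 4]. *)
have [/andP[/eqP-> /eqP->] _|ts4] := boolP ((t == 4) && (s == 4)).
  by vm_compute.
move: (2 ^ (t * _))%N => E.
have n_small : ((5 * (s + (s + 3 - t)))./2 + (5 * (t - 3))./2 <= 5 * s)%N by lia.
have n_large : (10 * s <= 2 * (5 * (s + (s + 3 - t)))./2 + 5 * (t - 3) + 1)%N by lia.
move: n_small n_large; set n := _./2 => n_small n_large cE.
(* The upward quotient is bounded by 5/3, 3/2 or 4/3 for [t >= 6], [t = 5] or [t = 4]; five times
   its fourth power is then below 64, 32 or 16. *)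
have [t6|t6] := leqP 6 t.
  have h : (3 * n.+2 <= 5 * (n.+2 - s.+1))%N by lia.
  have := bin_diag_add4 (isT : 3 <= 5) h.
  have : (64 <= 2 ^ t)%N by rewrite -[64]/(2 ^ 6)%N leq_exp2l.
  rewrite -[3 ^ 4]/81 -[5 ^ 4]/625; move: (2 ^ t)%N 'C(n, s) 'C(n + 5, s.+1) cE.
  move=> T c c' cE T64 hc.
  have : (s.+1 * (81 * c') <= s.+1 * (3125 * c))%N by nia.
  by rewrite leq_pmul2l //; nia.
have [t5|t5] := eqVneq t 5.
  have h : (2 * n.+2 <= 3 * (n.+2 - s.+1))%N by lia.
  have := bin_diag_add4 (isT : 2 <= 3) h.
  rewrite t5 -[2 ^ 5]/32 -[2 ^ 4]/16 -[3 ^ 4]/81.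
  move: 'C(n, s) 'C(n + 5, s.+1) cE => c c' cE hc.
  have : (s.+1 * (16 * c') <= s.+1 * (405 * c))%N by nia.
  by rewrite leq_pmul2l //; lia.
have {}t4 : t = 4 by lia.
have {}ts4 : (5 <= s)%N by lia.
have h : (3 * n.+2 <= 4 * (n.+2 - s.+1))%N by lia.
have := bin_diag_add4 (isT : 3 <= 4) h.
rewrite t4 -[2 ^ 4]/16 -[3 ^ 4]/81 -[4 ^ 4]/256.
move: 'C(n, s) 'C(n + 5, s.+1) cE => c c' cE hc.
have : (s.+1 * (81 * c') <= s.+1 * (1280 * c))%N by nia.
by rewrite leq_pmul2l //; lia.
Qed.

(** The tight case is the least [u], namely [s + 3 - t]: each further unit of [u] costs a factor at
    most 5 on the left and gains [2 ^ t >= 16] on the right. *)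
Lemma bin_lt_exp2 (t s u n : nat) :
  (4 <= t <= s -> s + 3 <= u + t -> 2 * n <= 5 * (s + u) ->
   'C(n, s) < 2 ^ (t * u))%N.
Proof.
move=> ts sut nsu; have /bin_half5_min := ts.
have [m um] : exists m, u = (s + 3 - t + m)%N by exists (u + t - (s + 3))%N; lia.
have nn : (n <= (5 * (s + u))./2)%N by lia.
move=> base; apply: leq_ltn_trans (leq_bin2l _ nn) _; rewrite um {sut nsu nn um}.
elim: m => [|m IHm]; first by rewrite addn0.
rewrite addnS mulnS expnD; apply: leq_ltn_trans (bin_half5_succr _ _) _.
have : (16 <= 2 ^ t)%N by rewrite -[16]/(2 ^ 4)%N leq_exp2l //; lia.
nia.
Qed.

Local Open Scope ring_scope.

(** * Generalized weights and covering radii *)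

Lemma bigminn_le (I : finType) (P : pred I) (f : I -> nat) (n : nat) (i : I) :
  P i -> (\big[minn/n]_(j | P j) f j <= f i)%N.
Proof.
move=> Pi; have := mem_index_enum i.
elim: (index_enum I) => [//|j r IHr]; rewrite inE big_cons.
case/orP => [/eqP<-|/IHr le_r]; first by rewrite Pi geq_minl.
by case: ifP => // _; apply: leq_trans (geq_minr _ _) le_r.
Qed.

Lemma bigminn_ge (I : finType) (P : pred I) (f : I -> nat) (n m : nat) :
  (m <= n)%N -> (forall i, P i -> (m <= f i)%N) ->
  (m <= \big[minn/n]_(j | P j) f j)%N.
Proof.
move=> le_mn le_mf; apply: (big_ind (fun x => m <= x)%N) => // a b le_ma le_mb.
by rewrite leq_min le_ma.
Qed.

Lemma generator_matrix (F : finFieldType) (n : nat) (C : {vspace 'rV[F]_n}) :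
  exists2 G : 'M[F]_(\dim C, n),
    \rank G = \dim C & forall v : 'rV[F]_n, (v \in C) = (v <= G)%MS.
Proof.
pose G : 'M[F]_(\dim C, n) := \matrix_i (vbasis C)`_i.
have sumG (x : 'rV_(\dim C)) : x *m G = \sum_i x 0 i *: (vbasis C)`_i.
  by rewrite mulmx_sum_row; apply: eq_bigr => i _; rewrite rowK.
exists G.
  apply/eqP; rewrite -/(row_free G) -kermx_eq0; apply/rowV0P => x.
  move/sub_kermxP; rewrite sumG => x0.
  have /freeP freeC := basis_free (vbasisP C).
  by apply/rowP => i; rewrite (freeC (x 0)) // mxE.
move=> v; apply/idP/submxP => [Cv|[x ->]].
  exists (\row_i coord (vbasis C) i v); rewrite sumG {1}(coord_vbasis Cv).
  by apply: eq_bigr => i _; rewrite mxE.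
rewrite sumG memv_suml // => i _; rewrite memvZ // vbasis_mem //.
by rewrite mem_nth // size_tuple.
Qed.

Lemma code_powE (F : finFieldType) (n k t : nat) (C : {vspace 'rV[F]_n})
    (G : 'M[F]_(k, n)) (M : 'M[F]_(t, n)) :
  (forall v : 'rV[F]_n, (v \in C) = (v <= G)%MS) ->
  (M \in code_pow C t) = (M <= G)%MS.
Proof.
move=> CG; rewrite inE; by apply/forallP/row_subP => MG i; have := MG i; rewrite CG.
Qed.

(** [mxwt M] is convertible to the cardinal of this set. The number of rows is free so that supports
    of row spaces of different presentations can be compared. *)
Definition colsupp (F : fieldType) (p n : nat) (M : 'M[F]_(p, n)) :
    {set 'I_n} :=
  [set j | col j M != 0].

Lemma colsuppS (F : fieldType) (p p' n : nat) (M : 'M[F]_(p, n))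
    (N : 'M[F]_(p', n)) :
  (M <= N)%MS -> colsupp M \subset colsupp N.
Proof.
case/submxP=> X ->; apply/subsetP => j; rewrite !inE; apply: contraNN => /eqP N0.
by rewrite colE -mulmxA -colE N0 mulmx0.
Qed.

Lemma colsupp_col_mx (F : fieldType) (p p' n : nat) (M : 'M[F]_(p, n))
    (N : 'M[F]_(p', n)) :
  colsupp (col_mx M N) = colsupp M :|: colsupp N.
Proof.
by apply/setP => j; rewrite !inE col_col_mx col_mx_eq0 negb_and.
Qed.

Lemma rank_le_mxwt (F : finFieldType) (t n : nat) (M : 'M[F]_(t, n)) :
  (\rank M <= mxwt M)%N.
Proof.
rewrite -mxrank_tr.
have sub : (M^T <= \sum_(j in colsupp M) <<row j M^T>>)%MS.
  apply/row_subP => j; have [Mj|] := boolP (j \in colsupp M).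
    by apply: submx_trans (sumsmx_sup j Mj (submx_refl _)); rewrite genmxE.
  by rewrite inE negbK -tr_col => /eqP->; rewrite trmx0 sub0mx.
apply: leq_trans (mxrankS sub) _.
apply: leq_trans (mxrank_sum_leqif _) _ => /=.
rewrite /mxwt -/(colsupp M) -sum1_card leq_sum // => j _.
by rewrite mxrank_gen rank_leq_row.
Qed.

Lemma mxwt_ge_dist (F : finFieldType) (t n : nat) (V M : 'M[F]_(t, n)) :
  (mxwt M <= mxwt V + mxdist V M)%N.
Proof.
apply: (@leq_trans #|colsupp V :|: colsupp (V - M)|); last first.
  by rewrite /mxdist /mxwt -/(colsupp _) -/(colsupp _) leq_card_setU.
apply/subset_leq_card/subsetP => j; rewrite !inE.
by case: (eqVneq (col j V) 0) => //= Vj0; rewrite linearB /= Vj0 sub0r oppr_eq0.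
Qed.

(** [ghw] only ranges over matrices with [t] rows and rank exactly [t]; keeping [t] rows of a row
    basis of [M] gives one whose support is no larger. *)
Lemma ghw_le (F : finFieldType) (n t p k : nat) (C : {vspace 'rV[F]_n})
    (G : 'M[F]_(k, n)) (M : 'M[F]_(p, n)) :
  (forall v : 'rV[F]_n, (v \in C) = (v <= G)%MS) ->
  (M <= G)%MS -> (t <= \rank M)%N -> (ghw C t <= mxwt M)%N.
Proof.
move=> CG MG tM; pose N := (pid_mx t : 'M_(t, \rank M)) *m row_base M.
have NM : (N <= M)%MS by rewrite mulmx_sub // eq_row_base.
have rN : \rank N == t.
  by rewrite mxrankMfree ?row_base_free // rank_pid_mx.
have CN : N \in code_pow C t by rewrite (code_powE _ CG) (submx_trans NM).
apply: (@leq_trans (mxwt N)); last exact: subset_leq_card (colsuppS NM).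
by apply: (bigminn_le (P := fun X => _)); rewrite CN.
Qed.

Lemma gcovrad_ge (F : finFieldType) (n t m : nat) (C : {vspace 'rV[F]_n})
    (V : 'M[F]_(t, n)) :
  (m <= n)%N -> (forall M, M \in code_pow C t -> (m <= mxdist V M)%N) ->
  (m <= gcovrad C t)%N.
Proof.
by move=> mn VM; rewrite /gcovrad (bigD1 V) //= leq_max bigminn_ge.
Qed.

Lemma gcovrad_lt (F : finFieldType) (n t m : nat) (C : {vspace 'rV[F]_n})
    (V : 'M[F]_(t, n)) :
  (m <= n)%N -> (gcovrad C t < m)%N ->
  exists2 M, M \in code_pow C t & (mxdist V M < m)%N.
Proof.
move=> mn Cm; have [/exists_inP//|] :=
  boolP [exists (M | M \in code_pow C t), (mxdist V M < m)%N].
rewrite negb_exists_in => /forall_inP Vm.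
move: Cm; rewrite ltnNge (gcovrad_ge (V := V)) // => M /Vm.
by rewrite -leqNgt.
Qed.

(** Take for [V] [t] independent rows in a complement of [C]. For [M] over [C], a combination of
    rows killing [V - M] kills [V], so [V - M] has rank [t] and hence weight at least [t]. *)
Lemma gcovrad_ge_t (F : finFieldType) (n t : nat) (C : {vspace 'rV[F]_n}) :
  (t <= n - \dim C)%N -> (t <= gcovrad C t)%N.
Proof.
move=> tC; have [G rG CG] := generator_matrix C.
pose W := row_base (G^C)%MS.
have rW : \rank (G^C)%MS = (n - \dim C)%N by rewrite mxrank_compl rG.
pose V : 'M[F]_(t, n) := (pid_mx t : 'M_(t, _)) *m W.
have rV : \rank V = t.
  by rewrite mxrankMfree ?row_base_free // rank_pid_mx ?rW.
have VG : (V <= G^C)%MS by rewrite mulmx_sub // eq_row_base.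
apply: (gcovrad_ge (V := V)) => [|M]; first by lia.
rewrite (code_powE _ CG) => MG; apply: leq_trans (rank_le_mxwt _).
rewrite row_leq_rank -kermx_eq0; apply/rowV0P => x /sub_kermxP.
rewrite mulmxBr => /eqP; rewrite subr_eq0 => /eqP xVM.
have : (x *m V <= G :&: G^C)%MS.
  by rewrite sub_capmx (mulmx_sub _ VG) andbT xVM mulmx_sub.
rewrite capmx_compl submx0 => /eqP xV0.
have freeV : row_free V by rewrite /row_free rV.
by apply: (row_free_inj freeV); rewrite xV0 mul0mx.
Qed.

(** The codewords vanishing on the first [\dim C - t] coordinates form a subcode of dimension at
    least [t]. *)
Lemma ghw_singleton (F : finFieldType) (n t : nat) (C : {vspace 'rV[F]_n}) :
  (t <= \dim C)%N -> (ghw C t <= n - \dim C + t)%N.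
Proof.
move=> tC; have [G rG CG] := generator_matrix C.
have kn : (\dim C <= n)%N by rewrite -{1}rG rank_leq_col.
pose f (i : 'I_(\dim C - t)) : 'I_n := widen_ord (leq_trans (leq_subr _ _) kn) i.
pose K := kermx (colsub f G).
have rK : (t <= \rank K)%N.
  by rewrite mxrank_ker; have := rank_leq_col (colsub f G); lia.
have rKG : \rank (K *m G) = \rank K by rewrite mxrankMfree // /row_free rG.
apply: (@leq_trans (mxwt (K *m G))).
  by rewrite (ghw_le CG) ?submxMl ?rKG.
have K0 : colsub f (K *m G) = 0 by rewrite -mulmx_colsub mulmx_ker.
have injf : injective f by move=> i j /(congr1 val) /= ij; apply: val_inj.
have : colsupp (K *m G) \subset ~: (f @: setT).
  apply/subsetP => j; rewrite !inE; apply: contra => /imsetP[i _ ->].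
  by apply/eqP/colP => a; have /matrixP/(_ a i) := K0; rewrite !mxE.
move/subset_leq_card; rewrite [#|~: _|]cardsCs setCK card_imset // cardsT !card_ord.
by rewrite subnA.
Qed.

Lemma subset_of_card (T : finType) (A : {set T}) (s : nat) :
  (#|A| <= s <= #|T|)%N -> exists2 S : {set T}, A \subset S & #|S| = s.
Proof.
case/andP=> As sT; pose B := [set x in take (s - #|A|) (enum (~: A))].
have uB : uniq (take (s - #|A|) (enum (~: A))) by rewrite take_uniq ?enum_uniq.
exists (A :|: B); first exact: subsetUl.
rewrite cardsU [A :&: B](_ : _ = set0) ?cards0.
  rewrite cardsE (card_uniqP uB) size_takel -?cardE; first by lia.
  by rewrite [#|~: _|]cardsCs setCK; lia.
apply/setP => x; rewrite !inE; have [Ax|//] := boolP (x \in A).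
by apply/negbTE/negP => /mem_take; rewrite mem_enum inE Ax.
Qed.

(** Every matrix is a codeword matrix plus an error supported on [s] positions, so [decode] maps
    onto all of them; count both sides and cancel the codewords. *)
Lemma sphere_covering (F : finFieldType) (n t s : nat) (C : {vspace 'rV[F]_n}) :
  (s < n)%N -> (gcovrad C t <= s)%N ->
  (#|F| ^ (t * (n - \dim C)) <= 'C(n, s) * #|F| ^ (t * s))%N.
Proof.
move=> sn Rs; have [G rG CG] := generator_matrix C.
have kn : (\dim C <= n)%N by rewrite -{1}rG rank_leq_col.
pose decode (x : 'M[F]_(t, \dim C) * ({set 'I_n} * 'M[F]_(t, s))) : 'M[F]_(t, n) :=
  x.1 *m G + \matrix_(i, j)
    (if insub (index j (enum x.2.1)) is Some a then x.2.2 i a else 0).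
pose D := setX [set: 'M[F]_(t, \dim C)]
  (setX [set S : {set 'I_n} | #|S| == s] [set: 'M[F]_(t, s)]).
have : [set: 'M[F]_(t, n)] \subset decode @: D.
  apply/subsetP => V _; have [M CM VM] := gcovrad_lt V sn Rs.
  have /submxP[A MA] : (M <= G)%MS by rewrite -(code_powE _ CG).
  (* The support of the error is padded to exactly [s] positions; off [S] the index in [enum S] is
     [s], so [insub] fails and [decode] reads 0. *)
  have [|S sub cS] := @subset_of_card _ (colsupp (V - M)) s.
    by rewrite card_ord (ltnW sn) andbT -ltnS.
  pose B : 'M[F]_(t, s) :=
    \matrix_(i, a) nth 0 [seq (V - M) i j | j <- enum S] a.
  apply/imsetP; exists (A, (S, B)); first by rewrite !inE cS eqxx.
  rewrite /decode /= -MA; apply: (addrI (- M)); rewrite addKr addrC.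
  apply/matrixP => i j; rewrite [RHS]mxE.
  have [Sj|Sj] := boolP (j \in S).
    have js : (index j (enum S) < s)%N by rewrite -cS cardE index_mem mem_enum.
    rewrite insubT [RHS]mxE /= (nth_map j) ?nth_index ?mem_enum //.
    by rewrite index_mem mem_enum.
  rewrite insubF; last first.
    by apply/negbTE; rewrite -leqNgt -cS cardE leqNgt index_mem mem_enum.
  have : j \notin colsupp (V - M) by apply: contra Sj; apply: (subsetP sub).
  by rewrite inE negbK => /eqP/colP/(_ i); rewrite !mxE.
move/subset_leq_card; rewrite cardsT card_mx => /leq_trans/(_ (leq_imset_card _ _)).
rewrite !cardsX !cardsT card_draws !card_mx card_ord.
have -> : (t * n = t * \dim C + t * (n - \dim C))%N by rewrite -mulnDr subnKC.
rewrite expnD leq_pmul2l ?expn_gt0 //.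
by apply/orP; left; apply/card_gt0P; exists 0.
Qed.

(** * Placing columns greedily *)

Lemma mxwt_le (F : finFieldType) (t n : nat) (M : 'M[F]_(t, n)) :
  (mxwt M <= n)%N.
Proof. by rewrite -[leqRHS]card_ord max_card. Qed.

Lemma ghw_le_length (F : finFieldType) (n t : nat) (C : {vspace 'rV[F]_n}) :
  (ghw C t <= n)%N.
Proof.
apply: (big_ind (fun x => x <= n)%N) => // [x y xn _|M _].
  by rewrite geq_min xn.
exact: mxwt_le.
Qed.

(** The order of [p] is the order of placement, so extending [p] by [rcons] at a fresh position
    leaves the earlier columns unchanged. *)
Definition place (F : fieldType) (t n : nat) (v : nat -> 'rV[F]_t)
    (p : seq 'I_n) : 'M[F]_(t, n) :=
  \matrix_(a, j) (if j \in p then v (index j p) 0 a else 0).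

Lemma col_place (F : fieldType) (t n : nat) (v : nat -> 'rV[F]_t)
    (p : seq 'I_n) (j : 'I_n) :
  col j (place v p) = if j \in p then (v (index j p))^T else 0.
Proof. by apply/colP => a; rewrite !mxE; case: ifP; rewrite !mxE. Qed.

Lemma count_index (T : eqType) (p : seq T) (Q : pred nat) :
  uniq p -> count (fun x => Q (index x p)) p = count Q (iota 0 (size p)).
Proof.
case: p => [//|x0 p] up; rewrite -(count_map (index^~ (x0 :: p)) Q).
congr (count _ _); apply: (@eq_from_nth _ 0%N) => [|i].
  by rewrite size_map size_iota.
rewrite size_map => ip; rewrite (nth_map x0) // index_uniq // nth_iota //.
Qed.

(** [M] obstructs the placement of the next vector at [i]. The weight bound is the triangle
    inequality. The last bound holds because wherever [M] agrees with a placed column, that vector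
    lies in the column space of [M]. *)
Lemma place_stuck (F : finFieldType) (t n d : nat) (v : nat -> 'rV[F]_t)
    (p : seq 'I_n) (i : 'I_n) (M : 'M[F]_(t, n)) :
  uniq p -> i \notin p -> (size p < d)%N -> v (size p) != 0 ->
  (size p <= mxdist (place v p) M)%N ->
  (mxdist (place v (rcons p i)) M <= size p)%N ->
  [/\ i \in colsupp M, (mxwt M <= (size p).*2.+1)%N &
      (#|colsupp M :\: [set j in p]| <=
         count (fun a => v a <= M^T)%MS (iota 0 d))%N].
Proof.
move=> up ip pd v0 leader stuck.
set p' := rcons p i in stuck; pose T' := [set j in p'].
have up' : uniq p' by rewrite rcons_uniq ip.
have sp' : size p' = (size p).+1 by rewrite size_rcons.
have cT' : #|T'| = (size p).+1 by rewrite cardsE (card_uniqP up').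
have index_p' j : index j p' = if j \in p then index j p else (size p + (i != j))%N.
  by rewrite /p' -cats1 index_cat /=; case: (i =P j).
have mem_p' j : (j \in p') = (j == i) || (j \in p) by rewrite mem_rcons inE.
pose D := colsupp (place v p' - M).
have cD : (#|D| <= size p)%N := stuck.
have colD j : (j \in D) = (col j (place v p') != col j M).
  by rewrite inE linearB /= subr_eq0.
have iM : i \in colsupp M.
  apply/negPn/negP; rewrite inE negbK => /eqP Mi.
  (* If column [i] of [M] were zero, the new nonzero column would add one difference to the at least
     [size p] old ones. *)
  have : i |: colsupp (place v p - M) \subset D.
    apply/subsetP => j; rewrite !inE => /orP[/eqP->|].
      rewrite linearB /= Mi subr0 col_place mem_p' eqxx index_p' (negPf ip) eqxx.
      by rewrite addn0 -(inj_eq trmx_inj) trmxK trmx0.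
    rewrite !linearB /= !col_place mem_p' index_p'.
    case: (j =P i) => [->|_] /=; first by rewrite (negPf ip) Mi subrr !eqxx.
    by case: (j \in p).
  move/subset_leq_card; rewrite cardsU1 inE linearB /= Mi col_place.
  by rewrite (negPf ip) subrr eqxx add1n => /leq_trans/(_ cD); rewrite ltnNge leader.
split=> //.
  apply: leq_trans (mxwt_ge_dist (place v p') M) _.
  have : (mxwt (place v p') <= #|T'|)%N.
    apply/subset_leq_card/subsetP => j; rewrite !inE col_place.
    by case: ifP => //; rewrite eqxx.
  by rewrite cT'; move: stuck; lia.
have agree : (#|T' :\: D| <= count (fun a => v a <= M^T)%MS (iota 0 d))%N.
  apply: (@leq_trans (count (fun a => v a <= M^T)%MS (iota 0 (size p')))).
    rewrite -(count_index _ up') -size_filter cardE.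
    apply: uniq_leq_size (enum_uniq _) _ => j.
    rewrite mem_enum mem_filter in_setD colD negbK inE andbC => /andP[jp /eqP].
    rewrite col_place jp => /(congr1 trmx); rewrite trmxK tr_col => ->.
    by rewrite row_sub.
  by rewrite -(subnKC (_ : size p' <= d)%N) ?sp' // iotaD count_cat leq_addr.
apply: leq_trans agree.
have sub : colsupp M :\: [set j in p] \subset i |: (D :\: T').
  apply/subsetP => j; rewrite in_setD in_setU1 in_setD !in_set mem_p' => /andP[jp Mj].
  rewrite negb_or jp andbT linearB /= col_place mem_p' (negPf jp) orbF.
  by case: (j =P i) => //= _; rewrite sub0r oppr_eq0.
(* As [D] has fewer elements than [T'], the part of [D] outside [T'] is strictly smaller than the
   part of [T'] outside [D]; this strictness pays for [i]. *)
have := subset_leq_card sub; rewrite cardsU1 in_setD in_set mem_p' eqxx /= => le1.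
have := cardsID T' D; have := cardsID D T'; rewrite setIC cT' => e1 e2.
rewrite -(leq_add2l #|D :&: T'|) e1.
apply: (@leq_trans (#|D :&: T'| + (1 + #|D :\: T'|))); first by rewrite leq_add2l.
by rewrite addnCA e2 add1n ltnS.
Qed.

(** Start from [N0] and repeatedly add a [bad] matrix through a position not yet covered: the rank
    rises, and the support outside [T] grows by at most [B]. The bound by [n] guarantees an
    uncovered position. *)
Lemma cover_rank (F : fieldType) (t n k : nat) (G : 'M[F]_(k, n))
    (bad : pred 'M[F]_(t, n)) (T : {set 'I_n}) (B a : nat) (N0 : 'M[F]_(t, n)) :
  bad N0 -> (forall N, bad N -> (N <= G)%MS) ->
  (forall N, bad N -> (#|colsupp N :\: T| <= B)%N) ->
  (forall i, i \notin T -> exists2 N, bad N & i \in colsupp N) ->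
  (#|T| + a * B < n)%N ->
  exists2 U : 'M[F]_n, (U <= G)%MS &
    (\rank N0 + a <= \rank U)%N /\ (#|colsupp U :\: T| <= a.+1 * B)%N.
Proof.
move=> bad0 badG badB badT; elim: a => [_|a IHa aBn].
  exists <<N0>>%MS; first by rewrite genmxE badG.
  rewrite genmxE addn0 mul1n; split=> //; apply: leq_trans (badB _ bad0).
  by rewrite subset_leq_card // setSD // colsuppS // genmxE.
have [|U UG [rU sU]] := IHa; first by move: aBn; rewrite mulSn; lia.
have [rU'|rU'] := ltnP (\rank N0 + a) (\rank U).
  by exists U => //; rewrite addnS; split=> //; rewrite mulSn; lia.
have : #|T :|: colsupp U| != n.
  rewrite neq_ltn; apply/orP; left; apply: leq_ltn_trans aBn.
  rewrite -(setID (T :|: colsupp U) T) setUK setDUl setDv set0U.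
  apply: (leq_trans (leq_card_setU _ _)); rewrite leq_add2l //.
have [i iTU|full] := pickP [pred i | i \notin T :|: colsupp U]; last first.
  rewrite -[n in _ != n]card_ord -cardsT.
  rewrite (_ : T :|: _ = setT) ?eqxx //.
  by apply/setP => i; have /negbFE := full i; rewrite !inE.
move: iTU; rewrite /= inE negb_or => /andP[iT iU] _.
have [N badN iN] := badT i iT.
exists (U + N)%MS; first by rewrite addsmx_sub UG badG.
split.
  rewrite addnS; apply: leq_ltn_trans rU _; apply: rank_ltmx.
  rewrite ltmxE addsmxSl addsmx_sub submx_refl /=.
  by apply: contra iU => /colsuppS/subsetP->.
have sub : colsupp (U + N)%MS \subset colsupp U :|: colsupp N.
  by rewrite -colsupp_col_mx colsuppS // addsmxE.
apply: (leq_trans (subset_leq_card (setSD T sub))).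
rewrite setDUl; apply: (leq_trans (leq_card_setU _ _)).
by rewrite [leqRHS]mulSn addnC leq_add // badB.
Qed.

(** The [d.+1] is a weight budget: at most [d - 1] placed columns and [d + 1] further positions stay
    within [d.*2], below the [t]-th weight. *)
Lemma le_gcovrad_of_seq (F : finFieldType) (n t d : nat)
    (C : {vspace 'rV[F]_n}) (v : nat -> 'rV[F]_t) :
  (d.*2 < ghw C t)%N ->
  (forall a, (a < d)%N -> v a != 0) ->
  (forall X : 'M[F]_(n, t), (0 < \rank X < t)%N ->
     ((t - \rank X).+1 * count (fun a => v a <= X)%MS (iota 0 d) <= d.+1)%N) ->
  (d <= gcovrad C t)%N.
Proof.
move=> dC v0 vX; have [G rG CG] := generator_matrix C.
have dn : (d.*2 < n)%N := leq_trans dC (ghw_le_length t C).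
suff [p [up sp leader]] : exists p : seq 'I_n, [/\ uniq p, size p = d &
    forall M, M \in code_pow C t -> (size p <= mxdist (place v p) M)%N].
  by apply: (gcovrad_ge (V := place v p)); [lia | rewrite -sp].
have : (d <= d)%N by []; elim: {1 3}d => [_|m IHm md]; first by exists [::]; split.
have [p [up sp leader]] := IHm (ltnW md).
have [/existsP[i /andP[ip /forall_inP leader']]|/existsPn stuck] := boolP
  [exists i, (i \notin p) &&
     [forall (M | M \in code_pow C t), (m < mxdist (place v (rcons p i)) M)%N]].
  by exists (rcons p i); rewrite rcons_uniq ip size_rcons sp; split.
have spd : (size p < d)%N by rewrite sp.
have vp : v (size p) != 0 := v0 _ spd.
exfalso; pose T := [set j in p].
have cT : #|T| = m by rewrite cardsE (card_uniqP up).
pose bad (M : 'M[F]_(t, n)) := (M \in code_pow C t) &&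
  [exists i, (i \notin p) && (mxdist (place v (rcons p i)) M <= m)%N].
have badT i : i \notin p -> exists2 N, bad N & i \in colsupp N.
  move=> ip; have := stuck i; rewrite ip /= negb_forall_in.
  case/exists_inP=> M CM; rewrite -leqNgt => distM; exists M.
    by rewrite /bad CM; apply/existsP; exists i; rewrite ip.
  by rewrite -sp in distM; have [] := place_stuck up ip spd vp (leader _ CM) distM.
have badP N : bad N -> [/\ (N <= G)%MS, (0 < \rank N < t)%N &
    (#|colsupp N :\: T| <= count (fun a => v a <= N^T)%MS (iota 0 d))%N].
  case/andP=> CN /existsP[i /andP[ip distN]].
  rewrite -sp in distN; have [] := place_stuck up ip spd vp (leader _ CN) distN.
  rewrite sp => iN wN sN; have NG : (N <= G)%MS by rewrite -(code_powE _ CG).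
  split=> //.
  rewrite lt0n mxrank_eq0 ltnNge; apply/andP; split.
    by apply: contraTneq iN => ->; rewrite inE negbK col0.
  by apply/negP => /(ghw_le CG NG); move: dC; lia.
have [i0 i0p] : exists i, i \notin p.
  have [i ip|full] := pickP [pred i | i \notin p]; first by exists i.
  have : #|[set: 'I_n]| = #|T|.
    by apply: eq_card => i; have /negbFE := full i; rewrite !inE.
  by rewrite cardsT card_ord cT; lia.
have [N1 badN1 _] := badT i0 i0p.
(* The allowed count grows with the rank, so the bound [B] computed at maximal rank holds for every
   [bad] matrix. *)
have [N badN maxN] := arg_maxnP (fun N => \rank N) badN1.
have [NG /andP[N0 Nt] sN] := badP _ badN.
pose a := (t - \rank N)%N; pose B := (d.+1 %/ a.+1)%N.
have aB : (a.+1 * B <= d.+1)%N by rewrite mulnC leq_trunc_div.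
have [||||U UG [rU sU]] := @cover_rank _ t n _ G bad T B a N badN.
- by move=> M /badP[].
- move=> M badM; have [_ rM sM] := badP _ badM.
  apply: leq_trans sM _; rewrite leq_divRL // mulnC.
  have := vX M^T; rewrite mxrank_tr => /(_ rM); apply: leq_trans.
  by rewrite leq_mul2r ltnS leq_sub2l ?orbT //; apply: maxN.
- by move=> i; rewrite inE; apply: badT.
- by rewrite cT; move: aB; rewrite mulSn; lia.
have tU : (t <= \rank U)%N by rewrite /a in rU; lia.
have := ghw_le CG UG tU.
have : (mxwt U <= #|T| + #|colsupp U :\: T|)%N.
  by rewrite /mxwt -/(colsupp U) -(cardsID T) leq_add2r subset_leq_card ?subsetIr.
by rewrite cT; move: dC; lia.
Qed.

(** * Sequences of vectors spread over subspaces *)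

Lemma count_periodic (Q : pred nat) (p d : nat) :
  (forall a, Q (a + p)%N = Q a) ->
  count Q (iota 0 d) =
    (d %/ p * count Q (iota 0 p) + count Q (iota 0 (d %% p)))%N.
Proof.
move=> Qp; rewrite {1}(divn_eq d p); elim: (d %/ p)%N => [|k IHk].
  by rewrite mul0n.
rewrite mulSn -addnA iotaD count_cat mulSn -addnA -IHk add0n; congr (_ + _)%N.
rewrite -[p in iota p _]addn0 iotaDl count_map.
by apply: eq_count => a /=; rewrite addnC Qp.
Qed.

Lemma count_le1 (T : eqType) (Q : pred T) (s : seq T) :
  uniq s -> {in s &, forall a b, Q a -> Q b -> a = b} -> (count Q s <= 1)%N.
Proof.
elim: s => //= a s IHs /andP[as_ us] inj.
have {}IHs : (count Q s <= 1)%N.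
  by apply: IHs => // b c bs cs; apply: inj; rewrite inE ?bs ?cs orbT.
case Qa: (Q a) => //; rewrite [count _ _](_ : _ = 0)%N //.
apply/eqP; rewrite -leqn0 leqNgt -has_count; apply/hasPn => b bs; apply/negP => Qb.
by move: as_; rewrite (inj a b) ?bs // inE ?eqxx // bs orbT.
Qed.

(** A nonzero column of the cokernel is a linear form vanishing on the row space. *)
Lemma annihilator (F : fieldType) (m t : nat) (X : 'M[F]_(m, t)) :
  (\rank X < t)%N -> exists2 f : 'cV[F]_t, f != 0 &
    forall u : 'rV[F]_t, (u <= X)%MS -> u *m f = 0.
Proof.
move=> Xt; have : cokermx X != 0 by rewrite -mxrank_eq0 mxrank_coker subn_eq0 -ltnNge.
case/matrix0Pn => i [j ij]; exists (col j (cokermx X)).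
  by apply: contraNneq ij => /colP/(_ i); rewrite !mxE => ->.
by move=> u /submxP[x ->]; rewrite colE mulmxA -(mulmxA x) mulmx_coker mulmx0 mul0mx.
Qed.

(** Alternate the two unit vectors: a line contains at most one of them, hence at most half of [d],
    rounded up, of the sequence. *)
Lemma le_gcovrad2 (F : finFieldType) (n d : nat) (C : {vspace 'rV[F]_n}) :
  (d.*2 < ghw C 2)%N -> (d <= gcovrad C 2)%N.
Proof.
move=> dC; pose v (a : nat) : 'rV[F]_2 := \row_j (odd a == j :> nat)%:R.
have vE a (f : 'cV[F]_2) : (v a *m f) 0 0 = if odd a then f 1 0 else f 0 0 :> F.
  rewrite !mxE !big_ord_recl big_ord0 !mxE.
  case: (odd a); rewrite /= ?mul0r ?mul1r ?add0r ?addr0 //.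
  by congr (f _ _); apply: val_inj.
apply: (le_gcovrad_of_seq (v := v)) => // [a _|X /andP[X0 X2]].
  apply/negP => /eqP va; have := vE a (const_mx 1).
  by rewrite va mul0mx !mxE if_same => /esym/eqP; rewrite oner_eq0.
have [f f0 Xf] := annihilator X2.
pose Q a := (if odd a then f 1 0 else f 0 0) == 0.
have le_count : (count (fun a => v a <= X)%MS (iota 0 d) <= count Q (iota 0 d))%N.
  by apply: sub_count => a /Xf /matrixP/(_ 0 0); rewrite vE mxE /Q => ->.
have Q01 : (Q 0 + Q 1 <= 1)%N.
  rewrite /Q /=; case: eqP => // f00; case: eqP => // f10.
  case/eqP: f0; apply/colP => i; rewrite mxE.
  case: i => [[|[|//]] p]; [rewrite -[RHS]f00 | rewrite -[RHS]f10];
  by congr (f _ _); apply: val_inj.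
have /(_ d) := @count_periodic Q 2; rewrite /= !addn0 => eQ.
rewrite {}eQ in le_count; last by move=> a; rewrite /Q addn2 /= negbK.
have := ltn_pmod d (isT : 0 < 2)%N; have := divn_eq d 2.
have : (count Q (iota 0 (d %% 2)) <= d %% 2)%N.
  by rewrite -[leqRHS](size_iota 0) count_size.
have -> : \rank X = 1%N by lia.
nia.
Qed.

(* Ordered so that every prefix of length r <> 2, and not only the whole list,
   has at most (r + 1) / 2 points on each plane through 0. *)
Definition fano : seq (seq bool) :=
  [:: [:: true; false; false]; [:: false; true; false]; [:: false; false; true];
      [:: true; true; true]; [:: true; true; false]; [:: true; false; true];
      [:: false; true; true]].

(** The bits are read as 0 and 1 in any field; over the field with two elements these are the points
    of the Fano plane. *)
Definition fano_seq (F : fieldType) (a : nat) : 'rV[F]_3 :=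
  \row_j (nth false (nth [::] fano (a %% 7)) j)%:R.

(** [w] lists the values of the linear form with coefficients [x], [y], [z] at the vectors of
    [fano], so [Q] marks those on its plane. *)
Lemma fano_zeros (F : fieldType) (x y z : F) :
  [|| x != 0, y != 0 | z != 0] ->
  let w := [:: x; y; z; x + y + z; x + y; x + z; y + z] in
  let Q a := w`_a == 0 in
  forall r, (r <= 7)%N ->
  (count Q (iota 0 r) <= 3)%N && (2 * count Q (iota 0 r) <= r.+1 + (r == 2))%N.
Proof.
move=> nz w Q r r7; pose bound k := (count Q (iota 0 k) <= 3)%N &&
  (2 * count Q (iota 0 k) <= k.+1 + (k == 2))%N.
suff /allP : all bound (iota 0 8) by apply; rewrite mem_iota.
rewrite /bound /Q {Q bound r7} /=.
(* These implications hold in every characteristic and reduce the goal to a check over seven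
   booleans. *)
have e1 : (x == 0) && (x + y == 0) ==> (y == 0).
  by apply/implyP => /andP[/eqP->]; rewrite add0r.
have e2 : (x == 0) && (x + z == 0) ==> (z == 0).
  by apply/implyP => /andP[/eqP->]; rewrite add0r.
have e3 : (y == 0) && (x + y == 0) ==> (x == 0).
  by apply/implyP => /andP[/eqP->]; rewrite addr0.
have e4 : (y == 0) && (y + z == 0) ==> (z == 0).
  by apply/implyP => /andP[/eqP->]; rewrite add0r.
have e5 : (z == 0) && (x + z == 0) ==> (x == 0).
  by apply/implyP => /andP[/eqP->]; rewrite addr0.
have e6 : (z == 0) && (y + z == 0) ==> (y == 0).
  by apply/implyP => /andP[/eqP->]; rewrite addr0.
have e7 : (x + y == 0) && (x + y + z == 0) ==> (z == 0).
  by apply/implyP => /andP[/eqP->]; rewrite add0r.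
have e8 : (x + z == 0) && (x + y + z == 0) ==> (y == 0).
  by apply/implyP => /andP[/eqP xz]; rewrite addrAC xz add0r.
have e9 : (y + z == 0) && (x + y + z == 0) ==> (x == 0).
  by apply/implyP => /andP[/eqP yz]; rewrite -addrA yz addr0.
have e10 : [&& x == 0, y == 0 & x + y + z == 0] ==> (z == 0).
  by apply/implyP => /and3P[/eqP-> /eqP->]; rewrite !add0r.
have e11 : [&& x == 0, z == 0 & x + y + z == 0] ==> (y == 0).
  by apply/implyP => /and3P[/eqP-> /eqP->]; rewrite add0r addr0.
have e12 : [&& y == 0, z == 0 & x + y + z == 0] ==> (x == 0).
  by apply/implyP => /and3P[/eqP-> /eqP->]; rewrite !addr0.
move: nz e1 e2 e3 e4 e5 e6 e7 e8 e9 e10 e11 e12.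
move: (x == 0) (y == 0) (z == 0) (x + y + z == 0).
move: (x + y == 0) (x + z == 0) (y + z == 0).
move=> b4 b5 b6 b0 b1 b2 b3.
case: b0; case: b1; case: b2; case: b3; case: b4; by case: b5; case: b6.
Qed.

Lemma fano_inj (a b : nat) : (a < 7)%N -> (b < 7)%N ->
  (forall j, (j < 3)%N ->
     nth false (nth [::] fano a) j = nth false (nth [::] fano b) j) -> a = b.
Proof.
move=> a7 b7 eqab; move: (eqab 0%N isT) (eqab 1%N isT) (eqab 2%N isT) => {eqab}.
case: a a7 => [|[|[|[|[|[|[|//]]]]]]] _;
  by case: b b7 => [|[|[|[|[|[|[|//]]]]]]] _.
Qed.

Lemma fano_seq_neq0 (F : fieldType) (a : nat) : fano_seq F a != 0.
Proof.
apply/negP => /eqP/rowP a0.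
have bit j : (j < 3)%N -> nth false (nth [::] fano (a %% 7)) j = false.
  move=> j3; have := a0 (Ordinal j3); rewrite !mxE /=.
  by case: nth => // /eqP; rewrite oner_eq0.
move: (bit 0%N isT) (bit 1%N isT) (bit 2%N isT) => {bit a0}.
move: (ltn_pmod a (isT : 0 < 7)%N).
by case: (a %% 7)%N => [|[|[|[|[|[|[|//]]]]]]].
Qed.

(** Proportional nonzero vectors have the same support, and a vector of zeros and ones is determined
    by its support. *)
Lemma fano_seq_rank1 (F : fieldType) (m a b : nat) (X : 'M[F]_(m, 3)) :
  \rank X = 1%N -> (a < 7)%N -> (b < 7)%N ->
  (fano_seq F a <= X)%MS -> (fano_seq F b <= X)%MS -> a = b.
Proof.
move=> X1 a7 b7 aX bX.
have line c d : (fano_seq F c <= X)%MS -> (fano_seq F d <= X)%MS ->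
    exists l, fano_seq F c = l *: fano_seq F d.
  move=> cX dX; apply/sub_rVP; apply: submx_trans cX _.
  by rewrite -(mxrank_leqif_sup dX) X1 rank_rV fano_seq_neq0.
have bits c d j : (fano_seq F c <= X)%MS -> (fano_seq F d <= X)%MS -> (j < 3)%N ->
    nth false (nth [::] fano (c %% 7)) j -> nth false (nth [::] fano (d %% 7)) j.
  move=> cX dX j3 cj; have [l /rowP/(_ (Ordinal j3))] := line c d cX dX.
  rewrite !mxE /= cj; case: nth => //; rewrite mulr0 => /eqP.
  by rewrite oner_eq0.
apply: fano_inj => // j j3; apply/idP/idP => h.
  by have := bits a b j aX bX j3; rewrite !modn_small //; apply.
by have := bits b a j bX aX j3; rewrite !modn_small //; apply.
Qed.

Lemma le_gcovrad3 (F : finFieldType) (n d : nat) (C : {vspace 'rV[F]_n}) :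
  (3 < d)%N -> (d.*2 < ghw C 3)%N -> (d <= gcovrad C 3)%N.
Proof.
move=> d3 dC; apply: (le_gcovrad_of_seq (v := fano_seq F)) => //.
  by move=> a _; apply: fano_seq_neq0.
move=> X /andP[X0 X3].
have per a : (fano_seq F (a + 7) <= X)%MS = (fano_seq F a <= X)%MS.
  by rewrite (_ : fano_seq F (a + 7) = fano_seq F a) // /fano_seq modnDr.
rewrite (count_periodic d per).
set Q := fun a => (fano_seq F a <= X)%MS.
have dE := divn_eq d 7; have r7 := ltn_pmod d (isT : 0 < 7)%N.
have [X1|X1] := eqVneq (\rank X) 1%N.
  have c7 r : (r <= 7)%N -> (count Q (iota 0 r) <= 1)%N.
    move=> r7'; apply: count_le1 (iota_uniq _ _) _ => a b.
    rewrite !mem_iota /= add0n => ar br; apply: fano_seq_rank1 => //; lia.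
  have := c7 7 isT; have := c7 _ (ltnW r7); rewrite X1.
  have : (count Q (iota 0 (d %% 7)) <= d %% 7)%N.
    by rewrite -[leqRHS](size_iota 0) count_size.
  move: (count _ _) (count _ _) => c7Q cr crr cr1 c71.
  have := leq_mul2l (d %/ 7) c7Q 1; rewrite c71 orbT muln1; lia.
have {X0 X1}X2 : \rank X = 2%N by lia.
have [f f0 Xf] := annihilator X3.
have nz : [|| f 0 0 != 0, f 1 0 != 0 | f 2%:R 0 != 0].
  rewrite -!negb_and; apply: contra f0 => /and3P[/eqP f00 /eqP f10 /eqP f20].
  apply/eqP/colP => i; rewrite mxE.
  case: i => [[|[|[|//]]] p];
    [rewrite -[RHS]f00 | rewrite -[RHS]f10 | rewrite -[RHS]f20];
    by congr (f _ _); apply: val_inj.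
pose w := [:: f 0 0; f 1 0; f 2%:R 0; f 0 0 + f 1 0 + f 2%:R 0; f 0 0 + f 1 0;
              f 0 0 + f 2%:R 0; f 1 0 + f 2%:R 0].
pose W a := w`_a == 0.
have zeros : forall r, (r <= 7)%N -> (count W (iota 0 r) <= 3)%N &&
  (2 * count W (iota 0 r) <= r.+1 + (r == 2))%N := fano_zeros nz.
have Qw a : (a < 7)%N -> Q a -> W a.
  move=> a7 /Xf/matrixP/(_ 0 0); rewrite !mxE !big_ord_recl big_ord0 !mxE modn_small //.
  have -> : ord0 = 0 :> 'I_3 by apply: val_inj.
  have -> : lift 0 0 = 1 :> 'I_3 by apply: val_inj.
  have -> : lift 0 (lift 0 0) = 2%:R :> 'I_3 by apply: val_inj.
  move=> e; apply/eqP; rewrite -[RHS]e; case: a a7 {e} => [|[|[|[|[|[|[|//]]]]]]] _ /=;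
    by rewrite ?mulr1n ?mulr0n ?mul1r ?mul0r ?addr0 ?add0r ?addrA.
have le_count r : (r <= 7)%N -> (count Q (iota 0 r) <= count W (iota 0 r))%N.
  move=> r7'; rewrite -!size_filter; apply: uniq_leq_size.
    by rewrite filter_uniq ?iota_uniq.
  move=> a; rewrite !mem_filter => /andP[Qa ar]; rewrite ar andbT; apply: Qw => //.
  by move: ar; rewrite mem_iota; lia.
have := le_count 7 isT; have := le_count _ (ltnW r7).
rewrite X2; have /andP[c7 _] := zeros 7 isT; have /andP[_ cr] := zeros _ (ltnW r7).
move: (count _ _) (count _ _) c7 cr => wr w7 w73 wrr.
move: (count _ _) (count _ _) => Q7 Qr Qrr Q77.
have : (d %/ 7 * Q7 <= d %/ 7 * 3)%N by rewrite leq_mul2l (leq_trans Q77) ?orbT.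
(* A full period contributes 6 against 7, and this slack absorbs the extra unit for remainder 2;
   [3 < d] excludes [d = 2], where no full period is available. *)
lia.
Qed.

(** * Separation of the cases [t <= 3] and [t >= 4] *)

Theorem theorem10 (F : finFieldType) (n k : nat) (C : {vspace 'rV[F]_n})
    (hk : \dim C = k)
    (hrate : k%:R / n%:R <= 3%:R / 5%:R :> rat)
    (t : nat) (ht : (1 <= t <= minn k (n - k))%N) :
  (packrad C t <= gcovrad C t)%N.
Proof.
case/andP: ht => t1; rewrite leq_min => /andP[tk tr].
have tR : (t <= gcovrad C t)%N by rewrite gcovrad_ge_t // hk.
set d := packrad C t.
have [dt|td] := leqP d t; first exact: leq_trans dt tR.
(* [t < d] makes [d] positive, so the subtraction in [packrad] is not truncated. *)
have dC : (d.*2 < ghw C t)%N by rewrite /d /packrad in td *; lia.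
have [t4|t4] := ltnP t 4.
  move: t4 t1 td dC {tR tk tr}; rewrite {}/d.
  case: t => [|[|[|[|//]]]] // _ _; last exact: le_gcovrad3.
    2: by move=> _; apply: le_gcovrad2.
  move=> _ dC.
  (* For [t = 1] no rank lies strictly between 0 and [t], so any nonzero vectors serve. *)
  apply: (le_gcovrad_of_seq (v := fun => const_mx 1)) => // [a _|X].
    by apply/negP => /eqP/rowP/(_ 0); rewrite !mxE => /eqP; rewrite oner_eq0.
  by rewrite ltnS leqn0 => /andP[X0 X1]; rewrite (eqP X1) in X0.
have {hrate} rate : (5 * k <= 3 * n)%N.
  have n0 : (0 < n)%N by lia.
  move: hrate; rewrite ler_pdivrMr ?ltr0n // mulrAC ler_pdivlMr ?ltr0n //.
  by rewrite -!natrM ler_nat mulnC.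
have singleton : (ghw C t <= n - k + t)%N by rewrite -hk ghw_singleton ?hk.
rewrite leqNgt; apply/negP => Rd.
have [s ds] : exists s, d = s.+1 by exists d.-1; lia.
have ts : (t <= s)%N by rewrite -ltnS -ds (leq_ltn_trans tR).
have Rs : (gcovrad C t <= s)%N by rewrite -ltnS -ds.
(* From [d.*2 < ghw C t] and the Singleton bound, [2s + 3 <= n - k + t]; with [t <= s] this leaves
   [s + 3 <= n - k]. *)
have sr : (s < n - k)%N by lia.
have sn : (s < n)%N by lia.
have := sphere_covering sn Rs; rewrite hk.
have -> : (t * (n - k) = t * (n - k - s) + t * s)%N.
  by rewrite -mulnDr; congr (_ * _)%N; lia.
have q2 : (1 < #|F|)%N := card_finNzRing_gt1 F.
rewrite expnD leq_pmul2r ?expn_gt0 ?(ltnW q2) // leqNgt => /negP; apply.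
apply: (@leq_trans (2 ^ (t * (n - k - s)))); last by rewrite leq_exp2r // muln_gt0; lia.
apply: bin_lt_exp2; lia.
Qed.
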